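(* Let $L \ge 1$ be an integer and let $r_0$ be a uniformly random integer in $[0, 2^L)$. Let $b_1, \ldots, b_k$ be positive integers with $b = \prod_{i=1}^k b_i \le 2^L$. For each $i$ from $1$ to $k$, define integers $a_i, r_i$ by the full-width product $b_i \otimes r_{i-1} = (a_i, r_i)$, i.e. $b_i r_{i-1} = 2^L a_i + r_i$ with $0 \le r_i < 2^L$ (so $a_i$ is the most significant $L$ bits and $r_i$ the least significant $L$ bits of the $2L$-bit product). Then, conditioned on the event $r_k \ge (2^L \bmod b)$, the values $a_1, \ldots, a_k$ are independent and uniformly random integers with $0 \le a_i < b_i$ for each $i$.
   Context: All numbers are non-negative integers. For integers $a,b$ with $b>0$, $a \bmod b = a - b\lfloor a/b\rfloor \in [0,b)$. The full-width multiplication $a \otimes c = (x, y)$ means $x, y$ are the integers with $2^L x + y = ac$ and $0 \le y < 2^L$. *)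

(* Defs.v *)
From HB Require Import structures.
From mathcomp Require Export all_boot all_order all_algebra.
From mathcomp Require Export all_classical all_reals all_analysis.
Set Implicit Arguments.
Unset Strict Implicit.
Unset Printing Implicit Defensive.
Import Order.TTheory GRing.Theory Num.Theory.
Local Open Scope classical_set_scope.
Local Open Scope ring_scope.

Definition full_width_mul (L u v x y : nat) : Prop :=
  (2 ^ L * x + y = u * v)%N /\ (y < 2 ^ L)%N.

Section Probability.
Context {d : measure_display} {T : measurableType d} {R : realType}.

Definition prob (P : probability T R) (A : set T) : R := fine (P A).

(* When P E = 0 this is identically 0, so that neither [uniform_rv] (for n > 0)
   nor [mutually_independent] can hold for it. *)
Definition cond_prob (P : probability T R) (E A : set T) : R :=
  prob P (A `&` E) / prob P E.

(* Q is the (possibly conditional) probability: [prob P] or [cond_prob P E]. *)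
Definition uniform_rv (Q : set T -> R) (n : nat) (X : T -> nat) : Prop :=
  measurable_fun setT X /\
  forall m : nat,
    Q [set t | X t = m] = if (m < n)%N then n%:R^-1 else 0.

(* Every set of natural numbers is measurable, hence B is arbitrary. *)
Definition mutually_independent (Q : set T -> R) (I : finType)
    (X : I -> T -> nat) : Prop :=
  forall (J : {set I}) (B : I -> set nat),
    Q [set t | forall i, i \in J -> B i (X i t)] =
    \prod_(i in J) Q [set t | B i (X i t)].

End Probability.

(* Main.v *)
Require Import Defs.
From mathcomp Require Import zify ring.
Set Implicit Arguments.
Unset Strict Implicit.
Unset Printing Implicit Defensive.
Import Order.TTheory GRing.Theory Num.Theory.
Local Open Scope classical_set_scope.
Local Open Scope ring_scope.

(** Everything is a function of [r_0]. Put [N = 2 ^ L].  Telescoping the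
    products gives [b * r_0 = N * A + r_k], where [A] is the number with
    mixed-radix digits [a_1, ..., a_k] in bases [b_1, ..., b_k]. For fixed
    [A < b], the condition [r_k >= N %% b] leaves for [b * r_0] a window of
    length [N - N %% b = b * (N %/ b)], which contains exactly [N %/ b]
    multiples of [b].  Hence every digit string is hit by the same number of
    values of [r_0], and the digits are jointly uniform on the product. *)

(** * Mixed-radix digits produced by iterated multiplication *)

Section MixedRadix.
Local Open Scope nat_scope.
Variables (N : nat) (b : nat -> nat).

Fixpoint remainder (j m : nat) : nat :=
  if j is j'.+1 then (b j' * remainder j' m) %% N else m.

Definition digit (j m : nat) : nat := (b j * remainder j m) %/ N.

(** Horner's rule with [c 0] as the most significant digit, matching the order in which the
    multiplications emit the digits. *)
Fixpoint radix_value (c : nat -> nat) (j : nat) : nat :=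
  if j is j'.+1 then b j' * radix_value c j' + c j' else 0.

Lemma remainder_lt (j m : nat) : m < N -> remainder j m < N.
Proof.
by move=> mN; case: j => [|j] //=; rewrite ltn_mod; apply: leq_ltn_trans mN.
Qed.

Lemma digit_lt (j m : nat) : 0 < b j -> m < N -> digit j m < b j.
Proof.
move=> bj mN; rewrite ltn_divLR; last exact: leq_ltn_trans mN.
by rewrite ltn_pmul2l // remainder_lt.
Qed.

(** Multiplying the identity for [j] by [b j] and dividing [b j * remainder j m] by [N] moves one
    new digit into the Horner value, leaving the next remainder. *)
Lemma prod_mul_radix (j m : nat) :
  (\prod_(i < j) b i) * m = N * radix_value (digit^~ m) j + remainder j m.
Proof.
elim: j => [|j IH] /=; first by rewrite big_ord0 mul1n muln0.
rewrite big_ord_recr /= mulnAC IH /digit mulnDl [remainder j m * _]mulnC.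
rewrite {1}(divn_eq (b j * remainder j m) N).
by move: (_ %/ _) (_ %% _) => Q S; ring.
Qed.

Lemma radix_value_lt (c : nat -> nat) (j : nat) :
  (forall i, i < j -> c i < b i) -> radix_value c j < \prod_(i < j) b i.
Proof.
elim: j => [|j IH] cb /=; first by rewrite big_ord0.
rewrite big_ord_recr /= [ltnRHS]mulnC.
have V := IH (fun i ij => cb i (ltnW ij)).
apply: leq_trans (leq_mul (leqnn (b j)) V).
by rewrite mulnS addnC -addSn leq_add2r cb.
Qed.

(** The last digit is the residue of the value modulo [b j]; once it is subtracted, cancelling [b j]
    leaves the shorter string. *)
Lemma radix_value_inj (c c' : nat -> nat) (j : nat) :
  (forall i, i < j -> c i < b i) -> (forall i, i < j -> c' i < b i) ->
  radix_value c j = radix_value c' j -> forall i, i < j -> c i = c' i.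
Proof.
elim: j => [|j IH] cb cb' //= e i.
have cj := cb j (ltnSn j); have cj' := cb' j (ltnSn j).
have ec : c j = c' j.
  move: (congr1 (modn^~ (b j)) e).
  by rewrite ![b j * _]mulnC !modnMDl !modn_small.
have bj : 0 < b j by exact: leq_ltn_trans cj.
rewrite ltnS leq_eqVlt => /orP[/eqP -> //|].
apply: IH => [l lj|l lj|]; [exact/cb/ltnW|exact/cb'/ltnW|].
by apply/eqP; rewrite -(eqn_pmul2l bj); move: e; rewrite ec => /addIn ->.
Qed.

Lemma eq_radix_value (c c' : nat -> nat) (j : nat) :
  (forall i, i < j -> c i = c' i) -> radix_value c j = radix_value c' j.
Proof.
elim: j => [|j IH] //= cc; rewrite cc // IH // => i ij; exact/cc/ltnW.
Qed.

End MixedRadix.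

(** * Counting multiples of [b] in a window *)

Lemma sum_ord_window (N x q : nat) : (x + q <= N)%N ->
  (\sum_(m < N) (x <= m < x + q) = q)%N.
Proof.
(* This form holds for every [N], so the induction need not carry the bound; truncated subtraction
   covers [N <= x]. *)
move=> xqN; suff -> : (\sum_(m < N) (x <= m < x + q) = minn (N - x) q)%N by lia.
elim: N {xqN} => [|n IH]; first by rewrite big_ord0; lia.
by rewrite big_ord_recr /= IH; case: (leqP x n); case: (ltnP n (x + q)) => /=; lia.
Qed.

(** The condition places [b * m] in the interval from [N * A + N %% b] up to [N * A.+1] (excluded),
    which means [x <= m < x + q]. *)
Lemma count_quotient (N b A : nat) : (A < b)%N ->
  (\sum_(m < N) ((b * m) %/ N == A) && (N %% b <= (b * m) %% N) = N %/ b)%N.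
Proof.
move=> Ab; have b0 : (0 < b)%N by exact: leq_ltn_trans Ab.
set q := (N %/ b)%N; set rho := (N %% b)%N.
have eN : N = (q * b + rho)%N by exact: divn_eq.
have rb : (rho < b)%N by rewrite ltn_mod.
(* [x] is the ceiling of [(N * A + rho) / b]. *)
pose x := ((N * A + rho + b.-1) %/ b)%N.
have xle m : (x <= m)%N = (N * A + rho <= b * m)%N.
  by rewrite -ltnS ltn_divLR //; apply/idP/idP; nia.
have xq m : (m < x + q)%N = (b * m < N * A.+1)%N.
  (* Since [rho + q * b = N], shifting by [q] gives the ceiling of [N * A.+1 / b]. *)
  have -> : (x + q = (N * A.+1 + b.-1) %/ b)%N.
    by rewrite /x addnC -divnMDl //; congr (_ %/ _)%N; nia.
  by rewrite ltnNge -[(_ <= m)%N]ltnS ltn_divLR // -leqNgt; apply/idP/idP; nia.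
(* The window fits below [N] because [A < b] gives [N * A.+1 <= b * N]. *)
rewrite -[RHS](@sum_ord_window N x); last first.
  by rewrite leqNgt xq -leqNgt mulnC leq_mul2r Ab orbT.
apply: eq_bigr => m _; congr nat_of_bool.
have N0 : (0 < N)%N by exact: leq_ltn_trans (ltn_ord m).
rewrite xle xq.
have := divn_eq (b * m) N; have := ltn_pmod (b * m) N0.
move: (_ %/ _)%N (_ %% _)%N => Q S SN ->.
apply/andP/andP => [[/eqP -> h]|[h1 h2]]; first by split; nia.
have QA : Q = A.
  apply/eqP; rewrite eqn_leq -ltnS; apply/andP; split.
    by rewrite -(ltn_pmul2l N0); lia.
  by rewrite -ltnS -(ltn_pmul2l N0); lia.
by rewrite QA in h1 *; split => //; lia.
Qed.

(** * Equidistribution of digit strings over the accepted seeds *)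

Section Counting.
Local Open Scope nat_scope.
Variables (N k : nat) (b : nat -> nat).
Hypothesis b_gt0 : forall i, i < k -> 0 < b i.
Hypothesis prod_le : \prod_(i < k) b i <= N.

Let accepted (m : nat) := N %% \prod_(i < k) b i <= remainder N b k m.

(** By [prod_mul_radix], the quotient and remainder of [b * m] by [N], with [b] the full product,
    are the radix value of the digits and the final remainder. Injectivity of [radix_value] then
    reduces the claim to [count_quotient]. *)
Lemma count_digit_string (c : nat -> nat) : (forall i, i < k -> c i < b i) ->
  \sum_(m < N) [forall i : 'I_k, digit N b i m == c i] && accepted m
    = N %/ \prod_(i < k) b i.
Proof.
move=> cb; rewrite -(count_quotient N (radix_value_lt cb)).
apply: eq_bigr => m _; congr nat_of_bool.
have N0 : 0 < N by exact: leq_ltn_trans (ltn_ord m).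
have rN := remainder_lt b k (ltn_ord m).
rewrite (prod_mul_radix N) mulnC divnMDl // modnMDl divn_small // addn0.
rewrite (modn_small rN).
congr (_ && _); apply/forallP/eqP => [e|e i].
  by apply: eq_radix_value => i ik; have /eqP := e (Ordinal ik).
apply/eqP; move: e => /radix_value_inj; apply => // j jk.
exact: digit_lt (b_gt0 jk) _.
Qed.

(** Allows digits of all bases to live in the single type ['I_N], so that a digit string is an
    ordinary finite function. *)
Lemma base_le (i : 'I_k) : b i <= N.
Proof.
apply: leq_trans prod_le; rewrite (bigD1 i) //= leq_pmulr // prodn_gt0 // => j.
exact: b_gt0.
Qed.

(** The seeds are grouped by digit string: every admissible string has the same number of accepted
    seeds, and the admissible strings satisfying [B] form a product set. *)
Lemma count_digits (B : 'I_k -> pred nat) :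
  \sum_(m < N) [forall i, B i (digit N b i m)] && accepted m
    = N %/ (\prod_(i < k) b i) * \prod_(i < k) \sum_(j < b i) B i j.
Proof.
(* Distributivity turns the product of counts into a count of strings [f]. *)
have -> : \prod_(i < k) \sum_(j < b i) B i j =
    \sum_(f : {ffun 'I_k -> 'I_N})
      [forall i, B i (f i)] && [forall i, f i < b i].
  rewrite (eq_bigr (fun i : 'I_k => \sum_(j < N) B i j && (j < b i))).
    rewrite bigA_distr_bigA; apply: eq_bigr => f _ /=.
    have [/forallP Bf|] := boolP [forall i, B i (f i)]; last first.
      by rewrite negb_forall => /existsP[i Bi]; rewrite (bigD1 i) //= (negbTE Bi).
    have [/forallP lf|] := boolP [forall i, f i < b i]; last first.
      rewrite negb_forall => /existsP[i Bi].
      by rewrite (bigD1 i) //= (negbTE Bi) andbF.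
    by rewrite big1 // => i _; rewrite Bf lf.
  move=> i _; rewrite (big_ord_widen N (fun j => B i j : nat) (base_le i)).
  by rewrite big_mkcond; apply: eq_bigr => j _; case: (j < b i); rewrite ?andbT ?andbF.
have dlt (m : 'I_N) (i : 'I_k) : digit N b i m < b i.
  exact: digit_lt (b_gt0 _) _.
pose dig (m : 'I_N) : {ffun 'I_k -> 'I_N} :=
  [ffun i => Ordinal (leq_trans (dlt m i) (base_le i))].
rewrite (partition_big dig predT) //= big_distrr /=; apply: eq_bigr => f _.
have eqd m : (dig m == f) = [forall i : 'I_k, digit N b i m == f i].
  apply/eqP/forallP => [<- i|e]; first by rewrite ffunE.
  by apply/ffunP => i; apply/val_inj; rewrite ffunE /=; apply/eqP.
have [/forallP lf|nlf] := boolP [forall i, f i < b i]; last first.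
  rewrite andbF muln0 big1 // => m /eqP ef; case/negP: nlf; apply/forallP => i.
  by rewrite -ef ffunE; exact: dlt.
(* [count_digit_string] expects digits indexed by [nat], so [f] is extended by 0. *)
have [f0 ef0] : exists c : nat -> nat, forall i : 'I_k, c i = f i.
  by exists (fun j => if insub j is Some i then f i : nat else 0) => i; rewrite valK.
rewrite andbT -(@count_digit_string f0); last first.
  by move=> i ik; have := lf (Ordinal ik); rewrite -ef0.
rewrite big_distrl big_mkcond; apply: eq_bigr => m _ /=.
rewrite eqd; under [in RHS]eq_forallb do rewrite ef0.
case: forallP => [e|] //=.
have -> : [forall i, B i (digit N b i m)] = [forall i, B i (f i)].
  by apply: eq_forallb => i; rewrite (eqP (e i)).
by rewrite mulnb andbC.
Qed.

End Counting.

(** * From point masses to the probability of an arbitrary event *)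

Section UniformLaw.
Context {d : measure_display} {T : measurableType d} {R : realType}.
Variables (P : probability T R) (N : nat) (X : T -> nat).
Hypothesis unifX : uniform_rv (prob P) N X.

Let measurable_preX (Z : set nat) : measurable [set t | Z (X t)].
Proof. by rewrite -[X in measurable X]setTI; exact: unifX.1. Qed.

Let prob_preXU (Z1 Z2 : set nat) : (forall m, Z1 m -> ~ Z2 m) ->
  prob P [set t | Z1 (X t) \/ Z2 (X t)] =
  prob P [set t | Z1 (X t)] + prob P [set t | Z2 (X t)].
Proof.
move=> dis; rewrite /prob -fineD ?fin_num_measure//; congr fine.
rewrite -measureU //; apply/seteqP; split => // t [/= z1 z2].
exact: (dis (X t)).
Qed.

Let prob_window (Z : set nat) (n : nat) : (n <= N)%N ->
  prob P [set t | Z (X t) /\ (X t < n)%N] =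
  (\sum_(m < n) `[< Z m >])%:R / N%:R.
Proof.
elim: n => [|n IH] nN.
  rewrite big_ord0 mul0r (_ : [set _ | _] = set0) ?/prob ?measure0 //.
  by apply/seteqP; split => // t [].
rewrite big_ord_recr /= natrD mulrDl -IH; last exact: ltnW.
have -> : (`[< Z n >] : nat)%:R / N%:R = prob P [set t | Z (X t) /\ X t = n].
  case: asboolP => Zn.
    rewrite (_ : [set _ | _] = [set t | X t = n]) ?unifX.2 ?nN ?mul1r //.
    by apply/seteqP; split => t /= => [[] //|Xn]; rewrite Xn.
  rewrite mul0r (_ : [set _ | _] = set0) ?/prob ?measure0 //.
  by apply/seteqP; split => // t [/= ZX Xn]; rewrite Xn in ZX.
rewrite -(@prob_preXU (fun m => Z m /\ (m < n)%N) (fun m => Z m /\ m = n)).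
  congr prob; apply/seteqP; split => t /=.
    move=> [ZX]; rewrite ltnS leq_eqVlt => /orP[/eqP|]; first by right.
    by left.
  by case=> [[ZX /leqW Xn]|[ZX Xn]]; split => //; rewrite Xn.
by move=> m [_ mn] [_ e]; rewrite e ltnn in mn.
Qed.

Lemma uniform_prob (Z : set nat) : (0 < N)%N ->
  prob P [set t | Z (X t)] = (\sum_(m < N) `[< Z m >])%:R / N%:R.
Proof.
move=> N0.
(* The points below [N] already carry mass [N / N = 1], so finite additivity leaves nothing for the
   infinite tail. *)
have tail0 : prob P [set t | ~ (X t < N)%N] = 0.
  have dis m : True /\ (m < N)%N -> ~ ~ (m < N)%N by move=> [_ mN].
  have := prob_preXU dis; rewrite (@prob_window (fun=> True)) //.
  rewrite (_ : [set t | _ \/ _] = setT); last first.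
    by apply/seteqP; split => // t _ /=; case: (X t < N)%N; [left|right].
  rewrite {1}/prob probability_setT /= (eq_bigr (fun=> 1%N)).
    rewrite sum1_card card_ord divff ?pnatr_eq0 -?lt0n //.
    by move/eqP; rewrite -{1}[1]addr0 eq_sym => /eqP/addrI.
  by move=> m _; rewrite asboolT.
rewrite -prob_window //.
rewrite (_ : [set t | Z (X t)] =
  [set t | (Z (X t) /\ (X t < N)%N) \/ (Z (X t) /\ ~ (X t < N)%N)]).
  rewrite (@prob_preXU (fun m => Z m /\ (m < N)%N)
    (fun m => Z m /\ ~ (m < N)%N)); last by move=> m [_ ?] [].
  rewrite [X in _ + X](_ : _ = 0) ?addr0 //.
  apply/eqP; rewrite eq_le; apply/andP; split; last first.
    by rewrite /prob fine_ge0.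
  have mZ := measurable_preX (fun m => Z m /\ ~ (m < N)%N).
  have mT := measurable_preX (fun m => ~ (m < N)%N).
  rewrite -tail0 /prob fine_le ?fin_num_measure //.
  by apply: le_measure => [||t []//]; rewrite inE.
apply/seteqP; split => t /= => [ZX|[[]|[]]] //.
by case: (X t < N)%N; [left|right].
Qed.

End UniformLaw.

Theorem theorem1 (R : realType) (d : measure_display) (T : measurableType d)
    (P : probability T R) (L k : nat) (b : 'I_k -> nat)
    (r : nat -> T -> nat) (a : 'I_k -> T -> nat)
    (hL : (1 <= L)%N)
    (hr0 : uniform_rv (prob P) (2 ^ L)%N (r 0%N))
    (hb : forall i : 'I_k, (0 < b i)%N)
    (hprod : (\prod_(i < k) b i <= 2 ^ L)%N)
    (hmul : forall (i : 'I_k) (t : T),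
        full_width_mul L (b i) (r i t) (a i t) (r i.+1 t)) :
  let E := [set t : T | (2 ^ L %% \prod_(i < k) b i <= r k t)%N] in
  mutually_independent (cond_prob P E) a /\
  forall i : 'I_k, uniform_rv (cond_prob P E) (b i) (a i).
Proof.
move=> E; pose N := (2 ^ L)%N; have N0 : (0 < N)%N by rewrite expn_gt0.
(* [b'] extends [b] to the index type of [remainder] and [digit]; only its values below [k] are
   read. *)
pose b' (j : nat) := if insub j is Some i then b i else 1%N.
have b'E (i : 'I_k) : b' i = b i by rewrite /b' valK.
have prodE : (\prod_(i < k) b i = \prod_(i < k) b' i)%N.
  by apply: eq_bigr => i _; rewrite b'E.
have mulE (i : 'I_k) t : a i t = ((b i * r i t) %/ N)%N /\
    r i.+1 t = ((b i * r i t) %% N)%N.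
  have [<- rN] := hmul i t.
  by rewrite mulnC divnMDl // modnMDl divn_small // addn0 modn_small.
have rE t j : (j <= k)%N -> r j t = remainder N b' j (r 0%N t).
  elim: j => [|j IH] // jk /=.
  by have [_ ->] := mulE (Ordinal jk) t; rewrite -b'E /= IH // ltnW.
have aE (i : 'I_k) t : a i t = digit N b' i (r 0%N t).
  by rewrite (mulE i t).1 /digit b'E rE // ltnW.
have b'_gt0 i : (i < k)%N -> (0 < b' i)%N.
  by move=> ik; rewrite (b'E (Ordinal ik)).
have b'_le : (\prod_(i < k) b' i <= N)%N by rewrite -prodE.
pose q := (N %/ \prod_(i < k) b i)%N.
(* The event is a condition on [r 0] alone, so its probability is a count of seeds, which
   [count_digits] factorises. *)
have joint (B : 'I_k -> set nat) :
    prob P ([set t | forall i, B i (a i t)] `&` E) =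
    (q * \prod_(i < k) \sum_(j < b i) `[< B i j >])%:R / N%:R.
  pose Z m := (forall i : 'I_k, B i (digit N b' i m)) /\
    (N %% \prod_(i < k) b' i <= remainder N b' k m)%N.
  rewrite (_ : _ `&` _ = [set t | Z (r 0%N t)]).
    rewrite (uniform_prob hr0 Z) //; congr (_%:R / _).
    transitivity (q * \prod_(i < k) \sum_(j < b' i) `[< B i j >])%N.
      rewrite /q prodE -(count_digits b'_gt0 b'_le (fun i j => `[< B i j >])).
      apply: eq_bigr => m _; congr nat_of_bool.
      apply/asboolP/andP => [[h hm]|[/forallP h hm]]; split => //.
        by apply/forallP => i; apply/asboolP.
      by move=> i; apply/asboolP.
    by congr (_ * _)%N; apply: eq_bigr => i _; rewrite b'E.
  apply/seteqP; split => t /=; rewrite /E /= prodE (rE t k) //.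
    by move=> [h hE]; split => // i; rewrite -aE.
  by move=> [h hE]; split => // i; rewrite aE.
have prod_gt0 : (0 < \prod_(i < k) b i)%N by rewrite prodn_gt0.
(* This is where [hprod] makes [E] non-null, so that [q] can be cancelled below. *)
have q_gt0 : (0 < q)%N by rewrite divn_gt0.
have condE (B : 'I_k -> set nat) :
    cond_prob P E [set t | forall i, B i (a i t)] =
    \prod_(i < k) ((\sum_(j < b i) `[< B i j >])%:R / (b i)%:R).
  rewrite /cond_prob joint.
  (* [E] is itself the joint event in which every digit is unconstrained. *)
  have -> : prob P E = (q * \prod_(i < k) b i)%:R / N%:R.
    rewrite -[E]setTI (_ : setT = [set t | forall i : 'I_k, setT (a i t)]).
      rewrite (joint (fun=> setT)); congr ((_ * _)%:R / _); apply: eq_bigr => i _.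
      rewrite (eq_bigr (fun=> 1%N)) ?sum1_card ?card_ord // => j _.
      by rewrite asboolT.
    by apply/seteqP; split.
  rewrite prodf_div -!natr_prod !natrM -mulf_div divff ?mulr1; last first.
    by rewrite invr_eq0 pnatr_eq0 -lt0n.
  by rewrite -mulf_div divff ?mul1r // pnatr_eq0 -lt0n.
have full (i : 'I_k) : (\sum_(j < b i) `[< setT (j : nat) >])%:R / (b i)%:R = 1 :> R.
  rewrite (eq_bigr (fun=> 1%N)) => [|j _]; last by rewrite asboolT.
  by rewrite sum1_card card_ord divff // pnatr_eq0 -lt0n.
have condJ (J : {set 'I_k}) (B : 'I_k -> set nat) :
    cond_prob P E [set t | forall i, i \in J -> B i (a i t)] =
    \prod_(i in J) ((\sum_(j < b i) `[< B i j >])%:R / (b i)%:R).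
  (* Digits outside [J] are constrained only by [setT], and their factors are 1 by [full]. *)
  rewrite (_ : [set t | _] =
      [set t | forall i, (if i \in J then B i else setT) (a i t)]).
    rewrite (condE (fun i => if i \in J then B i else setT)) [RHS]big_mkcond.
    apply: eq_bigr => i _ /=.
    by case: ifP => // _; rewrite full.
  apply/seteqP; split => t /= h i; first by case: ifP => // /h.
  by move=> iJ; have := h i; rewrite iJ.
(* The marginals are the case of a singleton [J]; substituting them into [condJ] gives
   independence. *)
have cond1 (i : 'I_k) (B : set nat) : cond_prob P E [set t | B (a i t)] =
    (\sum_(j < b i) `[< B j >])%:R / (b i)%:R.
  have := condJ [set i]%SET (fun=> B); rewrite big_set1 => <-.
  congr cond_prob; apply/seteqP; split => t /= h.
    by move=> j; rewrite inE => /eqP ->.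
  by apply: h; rewrite inE.
split=> [J B|i].
  by rewrite condJ; apply: eq_bigr => i _; rewrite (cond1 i (B i)).
split=> [|m].
  rewrite (_ : a i = digit N b' i \o r 0%N); last by apply/funext => t /=.
  by apply: measurableT_comp => //; exact: hr0.1.
rewrite (cond1 i [set n | n = m]); case: ltnP => mb.
  rewrite (bigD1 (Ordinal mb)) //= asboolT // big1 ?mul1r // => j jm.
  by rewrite asboolF // => e; case/eqP: jm; apply/val_inj.
rewrite big1 ?mul0r // => j _; rewrite asboolF // => /= e.
by move: (ltn_ord j); rewrite e ltnNge mb.
Qed.
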